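(* Let $f:\Omega\to\mathbb H^3_1$ be a timelike immersion of a domain $\Omega\subset\mathbb R^2$ with unit normal $N$, mean curvature $H$ and Gaussian curvature $K$, and let $\theta\in\mathbb R$, $\theta\ne0$. Let $f^\theta=f\cosh\theta+N\sinh\theta$ be the parallel surface at distance $\theta$, and $\Delta_\theta=K\sinh^2\theta-H\sinh(2\theta)+\cosh(2\theta)$. (1) If $f$ has constant mean curvature $H$ with $|H|>1$ (which is exactly the condition for a real $\theta\neq0$ with $\tanh(2\theta)=1/H$ to exist) and $\theta$ is that value, then $\Delta_\theta=K\sinh^2\theta$, so $f^\theta$ is an immersion exactly at the points where $K\ne0$, and there it has constant Gaussian curvature $$K^\theta=\frac1{\sinh^2\theta}>0,\qquad\text{equivalently}\qquad K^\theta+1=\coth^2\theta.$$ (2) If $f$ has constant Gaussian curvature $K>0$ and $\theta$ satisfies $\sinh^2\theta=1/K$, then $\Delta_\theta=2\cosh\theta(\cosh\theta-H\sinh\theta)$, so $f^\theta$ is an immersion exactly where $H\ne\coth\theta$, and there it has constant mean curvature $$H^\theta=-\coth(2\theta).$$ In both cases $f^\theta$ has the same Gauss map as $f$.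
   Context: Ambient space. On the space $\mathfrak{gl}(2,\mathbb R)$ of real $2\times2$ matrices let $\langle X,Y\rangle=-\tfrac12\operatorname{tr}(X\bar Y)$, where $\bar Y=(\operatorname{tr}Y)\mathrm{Id}-Y$; then $\langle X,X\rangle=-\det X$. Anti-de Sitter 3-space is $\mathbb H^3_1=\{X:\langle X,X\rangle=-1\}=SL(2,\mathbb R)$ with the induced Lorentzian metric. All maps are smooth; a domain is a connected open set. An immersion $f$ is timelike if the induced metric is Lorentzian. A unit normal is $N$ with $\langle N,N\rangle=1$ and $N$ orthogonal to $f,f_x,f_y$; the Gauss map is $\nu=f^{-1}N\in\mathfrak{sl}(2,\mathbb R)$. The shape operator $S$ is defined by $S(f_x,f_y)^T=(N_x,N_y)^T$, and $K+1=\det S$, $H=-\tfrac12\operatorname{tr}S$. One has $\Delta_\theta=\det(\mathrm{Id}\cosh\theta+S\sinh\theta)$. Where $f^\theta$ is an immersion, its curvatures $K^\theta,H^\theta$ and its Gauss map $(f^\theta)^{-1}N^\theta$ are taken with respect to the unit normal $N^\theta=N\cosh\theta+f\sinh\theta$. *)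

(* Defs.v *)
From HB Require Import structures.
From mathcomp Require Import all_boot all_order all_algebra.
From mathcomp Require Import all_classical all_reals all_analysis.
Set Implicit Arguments.
Unset Strict Implicit.
Unset Printing Implicit Defensive.
Import Order.TTheory GRing.Theory Num.Theory.
Import numFieldNormedType.Exports.
Local Open Scope classical_set_scope.
Local Open Scope ring_scope.

Section Hyperbolic.
Variable R : realType.

Definition sinh (t : R) : R := (expR t - expR (- t)) / 2.
Definition cosh (t : R) : R := (expR t + expR (- t)) / 2.
Definition tanh (t : R) : R := sinh t / cosh t.
Definition coth (t : R) : R := cosh t / sinh t.

End Hyperbolic.

Section AntiDeSitter.
Variable R : realType.

Definition mxbar (Y : 'M[R]_2) : 'M[R]_2 := (\tr Y)%:M - Y.

Definition ip (X Y : 'M[R]_2) : R := - (2^-1 * \tr (X *m mxbar Y)).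

Definition H31 : set 'M[R]_2 := [set X | ip X X = -1].

End AntiDeSitter.

(* Maps on a domain of R^2 are total functions on row vectors; only their
   restriction to the (open) domain matters below. *)
Section Surfaces.
Variable R : realType.
Implicit Types (Omega : set 'rV[R]_2) (f N : 'rV[R]_2 -> 'M[R]_2).
Implicit Types (p : 'rV[R]_2) (theta : R).

(* i = 0 is the derivative in x, i = 1 the derivative in y. *)
Definition partial (i : 'I_2) f : 'rV[R]_2 -> 'M[R]_2 :=
  fun p => 'D_(delta_mx 0 i) f p.

Definition iter_partial (s : seq 'I_2) f : 'rV[R]_2 -> 'M[R]_2 :=
  foldr partial f s.

(* C^infinity: the partial derivatives of all orders exist and are
   continuous. *)
Definition smooth Omega f : Prop :=
  forall (s : seq 'I_2) p, Omega p ->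
    {for p, continuous (iter_partial s f)} /\
    (forall i : 'I_2, derivable (iter_partial s f) p (delta_mx 0 i)).

Definition immersed_at f p : Prop := free [:: partial 0 f p; partial 1 f p].

Definition first_form f p : 'M[R]_2 :=
  \matrix_(i, j) ip (partial i f p) (partial j f p).

(* Signature (1,1): congruent to diag(1, -1). *)
Definition lorentzian (G : 'M[R]_2) : Prop :=
  exists2 P : 'M[R]_2, P \in unitmx &
    P *m G *m P^T = diag_mx (\row_(j < 2) (-1) ^+ j).

Definition timelike_immersion Omega f : Prop :=
  [/\ smooth Omega f,
      forall p, Omega p -> H31 (f p),
      forall p, Omega p -> immersed_at f p
    & forall p, Omega p -> lorentzian (first_form f p)].

Definition unit_normal Omega f N : Prop :=
  smooth Omega N /\
  forall p, Omega p ->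
    [/\ ip (N p) (N p) = 1, ip (N p) (f p) = 0
      & forall i : 'I_2, ip (N p) (partial i f p) = 0].

Definition gauss_map f N p : 'M[R]_2 := invmx (f p) *m N p.

(* S (f_x, f_y)^T = (N_x, N_y)^T, row by row. *)
Definition is_shape f N p (S : 'M[R]_2) : Prop :=
  forall i : 'I_2, partial i N p = \sum_(j < 2) S i j *: partial j f p.

(* At an immersed point there is at most one such S, and there is one when N
   is a unit normal of f; the default value 0 is used otherwise. *)
Definition shape_op f N p : 'M[R]_2 := xget 0 [set S | is_shape f N p S].

(* Gaussian curvature, through the Gauss equation K + 1 = det S. *)
Definition gaussK f N p : R := \det (shape_op f N p) - 1.

Definition meanH f N p : R := - (2^-1 * \tr (shape_op f N p)).

Definition parallel f N theta : 'rV[R]_2 -> 'M[R]_2 :=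
  fun p => cosh theta *: f p + sinh theta *: N p.

Definition parallel_normal f N theta : 'rV[R]_2 -> 'M[R]_2 :=
  fun p => cosh theta *: N p + sinh theta *: f p.

Definition Delta f N theta p : R :=
  gaussK f N p * sinh theta ^+ 2 - meanH f N p * sinh (2 * theta)
  + cosh (2 * theta).

End Surfaces.

(* Main.v *)
(* If S is the shape operator of f, the frame of the parallel surface is
   f^theta_i = (cosh theta + sinh theta S) f_i and N^theta_i =
   (sinh theta + cosh theta S) f_i.  Hence f^theta is an immersion exactly where
   Delta_theta = det (cosh theta + sinh theta S) is nonzero, and its shape
   operator is (sinh theta + cosh theta S) (cosh theta + sinh theta S)^-1, whose
   determinant and trace are expressed through those of S.  The operator S
   exists because f, N, f_x, f_y are a basis of gl(2, R) and N_x, N_y are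
   orthogonal to f and N.  The Gauss map is preserved because N f^-1 N = f. *)
Require Import Defs.
From mathcomp Require Import all_boot all_order all_algebra.
From mathcomp Require Import all_classical all_reals all_analysis.
From mathcomp Require Import ring lra.
Set Implicit Arguments.
Unset Strict Implicit.
Unset Printing Implicit Defensive.
Import Order.TTheory GRing.Theory Num.Theory.
Import numFieldNormedType.Exports.
Local Open Scope classical_set_scope.
Local Open Scope ring_scope.

(** * Hyperbolic identities and the range of [tanh] *)

Section HyperbolicIdentities.
Variable R : realType.
Implicit Types t h : R.

Lemma cosh_gt0 t : 0 < cosh t.
Proof. by rewrite divr_gt0 ?addr_gt0 ?expR_gt0. Qed.

Lemma coshB_sinh_sqr t : cosh t ^+ 2 - sinh t ^+ 2 = 1.
Proof.
have := expRxMexpNx_1 t; rewrite /cosh /sinh => e.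
by rewrite -[RHS]e; field.
Qed.

Lemma cosh_double t : cosh (2 * t) = cosh t ^+ 2 + sinh t ^+ 2.
Proof.
by rewrite /cosh /sinh mulr_natl mulr2n opprD !expRD; field.
Qed.

Lemma sinh_double t : sinh (2 * t) = 2 * (sinh t * cosh t).
Proof. by rewrite /cosh /sinh mulr_natl mulr2n opprD !expRD; field. Qed.

Lemma sinh_eq0 t : (sinh t == 0) = (t == 0).
Proof.
rewrite /sinh mulf_eq0 invr_eq0 pnatr_eq0 orbF subr_eq0 (inj_eq (@expR_inj R)).
by apply/eqP/eqP => [|->]; [lra | rewrite oppr0].
Qed.

Lemma tanh_lt1 t : `|tanh t| < 1.
Proof.
rewrite /tanh normrM normfV (gtr0_norm (cosh_gt0 t)) ltr_pdivrMr ?cosh_gt0//.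
have := expR_gt0 t; have := expR_gt0 (- t).
by rewrite mul1r ltr_norml /sinh /cosh => ? ?; apply/andP; split; lra.
Qed.

Lemma tanh_eq0 t : (tanh t == 0) = (t == 0).
Proof.
by rewrite mulf_eq0 invr_eq0 (gt_eqF (cosh_gt0 t)) orbF sinh_eq0.
Qed.

(** With [e] the square root of [x], the left side is (e - 1/e) / (e + 1/e). This gives an explicit
    inverse of [tanh]. *)
Lemma tanh_half_ln (x : R) : 0 < x -> tanh (ln x / 2) = (x - 1) / (x + 1).
Proof.
move=> x0; set e := expR (ln x / 2).
have ee : e * e = x by rewrite -expRD -splitr lnK.
have e0 : 0 < e by exact: expR_gt0.
rewrite /tanh /sinh /cosh expRN -/e -ee; field.
by do ?[apply/andP; split]; apply: lt0r_neq0; nra.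
Qed.

Lemma tanh_double_surj h : 1 < `|h| ->
  exists t : R, [/\ t != 0, h != 0 & tanh (2 * t) = 1 / h].
Proof.
move=> h1; have h0 : h != 0 by rewrite -normr_gt0 (lt_trans ltr01).
have [hm hp] : h - 1 != 0 /\ h + 1 != 0.
  split; apply/eqP => e; move: h1.
    by have -> : h = 1 by [lra]; rewrite normr1 ltxx.
  by have -> : h = -1 by [lra]; rewrite normrN1 ltxx.
(* The solution of (x - 1) / (x + 1) = 1 / h. It is positive because h^2 > 1 gives h + 1 and h - 1
   the same sign. *)
pose x := (h + 1) / (h - 1).
have x0 : 0 < x.
  have : 0 < (h + 1) * (h - 1).
    have : 1 < h ^+ 2 by rewrite -real_normK ?num_real// expr_gt1.
    nra.
  rewrite /x; have [q|q|e] := ltgtP (h - 1) 0; last by rewrite e eqxx in hm.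
    by rewrite nmulr_lgt0// => ?; rewrite nmulr_lgt0 ?invr_lt0.
  by rewrite !pmulr_lgt0 ?invr_gt0.
have te : tanh (2 * (ln x / 4)) = 1 / h.
  rewrite (_ : 2 * _ = ln x / 2); last by field.
  rewrite tanh_half_ln// /x; field.
  rewrite h0 hm /= (_ : _ + _ = h * 2); last by ring.
  by rewrite mulf_neq0 ?pnatr_eq0.
(* If this parameter were zero, then 1 / h = tanh 0 = 0, and the inverse of 0 being 0, h would
   vanish. *)
exists (ln x / 4); split => //; apply: contraNneq h0 => t0.
move/eqP: te; rewrite t0 mulr0 div1r eq_sym.
rewrite (_ : tanh 0 = 0) ?invr_eq0//.
by apply/eqP; rewrite tanh_eq0.
Qed.

(** The forward direction is the explicit logarithm above; the converse follows from |tanh| < 1. *)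
Lemma tanh_double_range h :
  1 < `|h| <-> exists t : R, [/\ t != 0, h != 0 & tanh (2 * t) = 1 / h].
Proof.
split=> [|[t [t0 h0 e]]]; first exact: tanh_double_surj.
have := tanh_lt1 (2 * t); rewrite e div1r normfV invf_lt1 ?normr_gt0//.
Qed.

End HyperbolicIdentities.

(** * Two-by-two matrices and pairs of free vectors *)

Lemma ord2P (P : 'I_2 -> Prop) : P 0 -> P 1 -> forall i, P i.
Proof.
move=> P0 P1 i; case: (unliftP 0 i) => [j ->|->//].
by rewrite ord1 (_ : lift _ _ = 1)//; apply: val_inj.
Qed.

Lemma sum_ord2 (V : nmodType) (F : 'I_2 -> V) : \sum_(i < 2) F i = F 0 + F 1.
Proof.
by rewrite !big_ord_recl big_ord0 addr0; congr (_ + F _); apply: val_inj.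
Qed.

Lemma det_mx2 (R : comNzRingType) (A : 'M[R]_2) :
  \det A = A 0 0 * A 1 1 - A 0 1 * A 1 0.
Proof.
rewrite (expand_det_row _ 0) sum_ord2 /cofactor !det_mx11 !mxE /=.
have -> : lift (0 : 'I_2) (0 : 'I_1) = 1 by exact: val_inj.
have -> : lift (1 : 'I_2) (0 : 'I_1) = 0 by exact: val_inj.
by rewrite !expr0 expr1; ring.
Qed.

(** A homogenised characteristic polynomial. It evaluates the determinants of both cosh + sinh S and
    sinh + cosh S. *)
Lemma det_scalar_addZ2 (R : comNzRingType) (a b : R) (A : 'M[R]_2) :
  \det (a%:M + b *: A) = a ^+ 2 + a * b * \tr A + b ^+ 2 * \det A.
Proof. by rewrite !det_mx2 /mxtrace sum_ord2 !mxE /=; ring. Qed.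

Section Free2.
Variables (K : fieldType) (V : vectType K).

Lemma free2P (u v : V) :
  reflect (forall a b, a *: u + b *: v = 0 -> a = 0 /\ b = 0) (free [:: u; v]).
Proof.
apply: (iffP (@freeP _ _ 2 [tuple u; v])) => [uv a b|uv k].
  move=> e; have := uv (fun i => if i == 0 then a else b).
  by rewrite sum_ord2 => /(_ e) q; split; [exact: (q 0)|exact: (q 1)].
by rewrite sum_ord2 => /uv[? ?]; apply: ord2P.
Qed.

(** A relation with coefficient row w among the new vectors is the relation w A among the free
    [u 0], [u 1], so it is nontrivial exactly when w is a nonzero left kernel vector of [A]. *)
Lemma free2_mulmx (u : 'I_2 -> V) (A : 'M[K]_2) : free [:: u 0; u 1] ->
  free [:: \sum_(j < 2) A 0 j *: u j; \sum_(j < 2) A 1 j *: u j]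
    = (\det A != 0).
Proof.
move=> /free2P uf.
have combE (a b : K) : a *: (\sum_(j < 2) A 0 j *: u j)
    + b *: (\sum_(j < 2) A 1 j *: u j)
    = (a * A 0 0 + b * A 1 0) *: u 0 + (a * A 0 1 + b * A 1 1) *: u 1.
  by rewrite !sum_ord2 !scalerDr !scalerA !scalerDl addrACA.
apply/free2P/idP => [Af|A0 a b].
  apply/det0P => -[w w0 wA]; case/negP: w0; apply/eqP/rowP.
  have wAE j : w 0 0 * A 0 j + w 0 1 * A 1 j = 0.
    by move/rowP: wA => /(_ j); rewrite !mxE sum_ord2.
  have [|w00 w01] := Af (w 0 0) (w 0 1).
    by rewrite combE !wAE !scale0r addr0.
  by apply: ord2P; rewrite mxE.
rewrite combE => /uf[e0 e1]; move: A0; rewrite det_mx2 => A0.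
(* Cramer's rule: [a] and [b] times the determinant are combinations of the two vanishing
   coefficients. *)
split; apply: (mulIf A0); rewrite mul0r.
  transitivity ((a * A 0 0 + b * A 1 0) * A 1 1 -
     (a * A 0 1 + b * A 1 1) * A 1 0); first by ring.
  by rewrite e0 e1 !mul0r subr0.
transitivity ((a * A 0 1 + b * A 1 1) * A 0 0 -
     (a * A 0 0 + b * A 1 0) * A 0 1); first by ring.
by rewrite e0 e1 !mul0r subr0.
Qed.

End Free2.

(** * The inner product and the adjugate [mxbar] *)

Section InnerProduct.
Variable R : realType.
Implicit Types X Y Z : 'M[R]_2.

Lemma ipE X Y : ip X Y =
  - (2^-1 * (X 0 0 * Y 1 1 + X 1 1 * Y 0 0 - X 0 1 * Y 1 0 - X 1 0 * Y 0 1)).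
Proof.
rewrite /ip /mxbar /mxtrace !(sum_ord2, mxE) /=.
by congr (- (_ * _)); ring.
Qed.

Lemma ipC X Y : ip X Y = ip Y X.
Proof. by rewrite !ipE; ring. Qed.

Lemma ipDl X Y Z : ip (X + Y) Z = ip X Z + ip Y Z.
Proof. by rewrite !ipE !mxE; ring. Qed.

Lemma ipZl a X Y : ip (a *: X) Y = a * ip X Y.
Proof. by rewrite !ipE !mxE; ring. Qed.

Lemma ip0l X : ip 0 X = 0.
Proof. by rewrite -(scale0r 0) ipZl mul0r. Qed.

(** The polarisation of X * mxbar X = det X = - ip X X. For orthogonal X and Y it becomes a
    skew-symmetry, which drives the Gauss map computation. *)
Lemma mul_mxbar_polar X Y :
  X *m mxbar Y + Y *m mxbar X = (- (2 * ip X Y))%:M.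
Proof.
apply/matrixP; apply: ord2P; apply: ord2P;
rewrite ipE /mxbar /mxtrace !(sum_ord2, mxE) /=; by field.
Qed.

Lemma mul_mxbar X : X *m mxbar X = (\det X)%:M.
Proof.
apply/matrixP; apply: ord2P; apply: ord2P;
rewrite det_mx2 /mxbar /mxtrace !(sum_ord2, mxE) /=; by ring.
Qed.

Lemma mxbar_mul X : mxbar X *m X = (\det X)%:M.
Proof.
by rewrite -mul_mxbar /mxbar mulmxBl mulmxBr scalar_mxC.
Qed.

Lemma ip_det X : ip X X = - \det X.
Proof. by rewrite ipE det_mx2; field. Qed.

Lemma invmx2 X : \det X != 0 -> invmx X = (\det X)^-1 *: mxbar X.
Proof.
move=> d0; have u : X \in unitmx by rewrite unitmxE unitfE.
apply: (can_inj (mulKmx u)); rewrite mulmxV// -scalemxAr mul_mxbar.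
by rewrite scale_scalar_mx mulVf.
Qed.

End InnerProduct.

(** * Adapted frames and the product rule for [ip] *)

Section Frames.
Variable R : realType.

(** Pairing with [F] and [n] reads off the coefficients along them. Hence the four vectors are free,
    and a basis by dimension, and the coefficients of [W] along [F] and [n] vanish. *)
Lemma orthogonal_frame_span (F n W : 'M[R]_2) (u : 'I_2 -> 'M[R]_2) :
    ip F F = -1 -> ip n n = 1 -> ip n F = 0 ->
    (forall i, ip F (u i) = 0) -> (forall i, ip n (u i) = 0) ->
    free [:: u 0; u 1] -> ip W F = 0 -> ip W n = 0 ->
  exists c : 'I_2 -> R, W = \sum_(j < 2) c j *: u j.
Proof.
move=> FF nn nF Fu nu /free2P uf WF Wn.
have combF a b c d :
    ip (a *: F + (b *: n + (c *: u 0 + d *: u 1))) F = - a.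
  by rewrite !ipDl !ipZl FF nF !(ipC (u _)) !Fu; ring.
have combn a b c d :
    ip (a *: F + (b *: n + (c *: u 0 + d *: u 1))) n = b.
  by rewrite !ipDl !ipZl nn (ipC F) nF !(ipC (u _)) !nu; ring.
pose X := [tuple F; n; u 0; u 1].
have sumX (k : 'I_4 -> R) : \sum_(i < 4) k i *: X`_i =
    k 0 *: F + (k (inord 1) *: n + (k (inord 2) *: u 0 + k (inord 3) *: u 1)).
  rewrite !big_ord_recl big_ord0 addr0 /=.
  by do ![congr (_ + _)]; congr (k _ *: _); apply: val_inj; rewrite /= ?inordK.
have Xfree : free X.
  apply/freeP => k; rewrite sumX => e.
  have k0 : k 0 = 0.
    have := combF (k 0) (k (inord 1)) (k (inord 2)) (k (inord 3)).
    by rewrite e ip0l; lra.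
  have k1 : k (inord 1) = 0.
    have := combn (k 0) (k (inord 1)) (k (inord 2)) (k (inord 3)).
    by rewrite e ip0l.
  move: e; rewrite k0 k1 !scale0r !add0r => /uf[k2 k3].
  case=> -[|[|[|[|//]]]] i4; [rewrite -[RHS]k0|rewrite -[RHS]k1
    |rewrite -[RHS]k2|rewrite -[RHS]k3];
  by congr k; apply: val_inj; rewrite /= ?inordK.
have Xbasis : basis_of fullv X.
  by rewrite basisEfree Xfree subvf /= dimvf.
have := coord_basis Xbasis (memvf W); rewrite sumX => WE.
pose k i := coord X i W.
have /eqP a0 := combF (k 0) (k (inord 1)) (k (inord 2)) (k (inord 3)).
have b0 := combn (k 0) (k (inord 1)) (k (inord 2)) (k (inord 3)).
rewrite /k in a0 b0.
rewrite -WE WF eq_sym oppr_eq0 in a0; rewrite -WE Wn in b0.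
exists (fun j => if j == 0 then k (inord 2) else k (inord 3)).
by rewrite sum_ord2 /= /k {1}WE (eqP a0) -b0 !scale0r !add0r.
Qed.

Lemma derive_ip (V : normedModType R) (F G : V -> 'M[R]_2) p v :
    derivable F p v -> derivable G p v ->
  'D_v (fun q => ip (F q) (G q)) p = ip ('D_v F p) (G p) + ip (F p) ('D_v G p).
Proof.
move=> dF dG.
have entry (M : V -> 'M[R]_2) (dM : derivable M p v) i j :
    is_derive p v (fun q => M q i j) ('D_v M p i j).
  by rewrite derive_mx// mxE; apply/derivableP; move/derivable_mxP: dM.
have eF := entry _ dF; have eG := entry _ dG.
(* [ip] is rewritten as a polynomial in the entry functions, so that its derivative is found by the
   scalar rules. *)
pose a M i j : V -> R := fun q : V => (M q : 'M[R]_2) i j.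
pose P := - (2^-1 \*: (a F 0 0 * a G 1 1 + a F 1 1 * a G 0 0
                       - a F 0 1 * a G 1 0 - a F 1 0 * a G 0 1)).
have -> : (fun q => ip (F q) (G q)) = P by apply/funext => q; rewrite ipE.
have [_ ->] : is_derive p v P (ip ('D_v F p) (G p) + ip (F p) ('D_v G p)).
  apply: is_derive_eq; by rewrite !ipE /a /GRing.scale /=; ring.
by [].
Qed.

End Frames.

(** * Shape operators and the Gauss map of parallel surfaces *)

Section ParallelSurfaces.
Variable R : realType.
Implicit Types (Omega : set 'rV[R]_2) (f N : 'rV[R]_2 -> 'M[R]_2).
Implicit Types (p : 'rV[R]_2) (S : 'M[R]_2) (theta : R).

Lemma smooth_derivable Omega f p i : smooth Omega f -> Omega p ->
  derivable f p (delta_mx 0 i).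
Proof. by move=> sf /(sf [::])[]. Qed.

Lemma partial_ip Omega (f g : 'rV[R]_2 -> 'M[R]_2) p (i : 'I_2) (c : R) :
    open Omega -> smooth Omega f -> smooth Omega g -> Omega p ->
    (forall q, Omega q -> ip (f q) (g q) = c) ->
  ip (partial i f p) (g p) = - ip (f p) (partial i g p).
Proof.
move=> Oo sf sg Op fg; apply/eqP; rewrite -addr_eq0; apply/eqP.
rewrite -derive_ip;
  [|exact: smooth_derivable sf Op|exact: smooth_derivable sg Op].
(* The product is constant only on [Omega]; openness makes it constant near [p], which is all the
   derivative sees. *)
rewrite (@near_eq_derive _ _ _ _ (cst c)) ?derive_cst//.
by apply: (filterS _ (open_nbhs_nbhs (conj Oo Op))) => q /fg.
Qed.

Lemma shape_exists Omega f N p : open Omega -> timelike_immersion Omega f ->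
  unit_normal Omega f N -> Omega p -> exists S, is_shape f N p S.
Proof.
move=> Oo [sf fH fim _] [sN Nu] Op.
have [NN Nf Nfi] := Nu p Op; have ff : ip (f p) (f p) = -1 by exact: fH.
have fN_perp i : ip (f p) (partial i f p) = 0.
  have := partial_ip i Oo sf sf Op fH; rewrite (ipC (partial _ _ _)); lra.
have span i : exists c : 'I_2 -> R,
    partial i N p = \sum_(j < 2) c j *: partial j f p.
  (* The two remaining orthogonality goals come from differentiating ip N f = 0, where ip N f_i = 0
     is used, and ip N N = 1. *)
  apply: (orthogonal_frame_span ff NN Nf fN_perp Nfi (fim p Op)).
    have Nf0 q : Omega q -> ip (N q) (f q) = 0 by case/Nu.
    by rewrite (partial_ip i Oo sN sf Op Nf0) Nfi oppr0.
  have NN1 q : Omega q -> ip (N q) (N q) = 1 by case/Nu.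
  have := partial_ip i Oo sN sN Op NN1; rewrite (ipC (N p)); lra.
exists (\matrix_(i, j) sval (cid (span i)) j) => i.
rewrite {1}(svalP (cid (span i))).
by apply: eq_bigr => j _; rewrite mxE.
Qed.

Lemma is_shape_inj f N p S T : immersed_at f p ->
  is_shape f N p S -> is_shape f N p T -> S = T.
Proof.
move=> /free2P fim hS hT; apply/matrixP => i j; apply/eqP.
rewrite -subr_eq0; apply/eqP; move: j.
have [|d0 d1] := fim (S i 0 - T i 0) (S i 1 - T i 1); last exact: ord2P.
have := hT i; rewrite (hS i) !sum_ord2 => /eqP; rewrite -subr_eq0 => /eqP e.
by rewrite !scalerBl addrACA -opprD.
Qed.

Lemma shape_opP f N p : (exists S, is_shape f N p S) ->
  is_shape f N p (shape_op f N p).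
Proof. exact: xgetPex. Qed.

Lemma shape_op_eq f N p S : immersed_at f p -> is_shape f N p S ->
  shape_op f N p = S.
Proof.
move=> fim hS; apply: (is_shape_inj fim) (hS).
by apply: shape_opP; exists S.
Qed.

Lemma partial_parallel f N theta p (i : 'I_2) :
    derivable f p (delta_mx 0 i) -> derivable N p (delta_mx 0 i) ->
  partial i (parallel f N theta) p =
  cosh theta *: partial i f p + sinh theta *: partial i N p.
Proof.
move=> df dN; rewrite /partial.
have -> : parallel f N theta = cosh theta \*: f + sinh theta \*: N by [].
by rewrite deriveD; [rewrite !deriveZ|exact: derivableZ|exact: derivableZ].
Qed.

Lemma gauss_map_parallel f N theta p :
    H31 (f p) -> ip (N p) (N p) = 1 -> ip (N p) (f p) = 0 ->
  gauss_map (parallel f N theta) (parallel_normal f N theta) p =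
  gauss_map f N p.
Proof.
rewrite /H31 /= /gauss_map /parallel_normal /parallel => ff NN Nf.
set F := f p in ff Nf *; set n := N p in NN Nf *.
set c := cosh theta; set s := sinh theta.
have Fdet : \det F = 1 by rewrite -[LHS]opprK -ip_det ff opprK.
have ndet : \det n = -1 by rewrite -[LHS]opprK -ip_det NN.
have Finv : invmx F = mxbar F by rewrite invmx2 Fdet ?oner_eq0// invr1 scale1r.
(* Since [n] is orthogonal to [F], n * mxbar F = - F * mxbar n. Multiplying by [n] on the right
   leaves - det n * F, and det n = -1. *)
have nFn : n *m (invmx F *m n) = F.
  have := mul_mxbar_polar n F; rewrite Nf mulr0 oppr0 raddf0 => /eqP.
  rewrite addr_eq0 mulmxA Finv => /eqP ->.
  by rewrite mulNmx -mulmxA mxbar_mul ndet mul_mx_scalar scaleN1r opprK.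
have Du : c *: F + s *: n \in unitmx.
  rewrite unitmxE unitfE -oppr_eq0 -ip_det.
  have -> : ip (c *: F + s *: n) (c *: F + s *: n) = - (c ^+ 2 - s ^+ 2).
    rewrite ipDl !ipZl !(ipC _ (_ + _)) !ipDl !ipZl ff NN (ipC F) Nf; ring.
  by rewrite coshB_sinh_sqr oppr_eq0 oner_eq0.
(* After multiplication by the parallel point, it remains that (c F + s n) F^-1 n = c n + s F. *)
apply: (can_inj (mulKmx Du)); rewrite mulKVmx// mulmxDl -!scalemxAl nFn.
by rewrite mulKVmx// unitmxE unitfE Fdet oner_eq0.
Qed.

Lemma parallel_partial_shape f N theta p S (i : 'I_2) :
    derivable f p (delta_mx 0 i) -> derivable N p (delta_mx 0 i) ->
    is_shape f N p S ->
  partial i (parallel f N theta) p =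
    \sum_(j < 2) ((cosh theta)%:M + sinh theta *: S) i j *: partial j f p /\
  partial i (parallel_normal f N theta) p =
    \sum_(j < 2) ((sinh theta)%:M + cosh theta *: S) i j *: partial j f p.
Proof.
move=> df dN hS.
have key (a b : R) : \sum_(j < 2) (a%:M + b *: S) i j *: partial j f p =
    a *: partial i f p + b *: partial i N p.
  rewrite hS scaler_sumr; under eq_bigr do rewrite !mxE scalerDl -scalerA.
  rewrite big_split /= (bigD1 i)//= eqxx mulr1n big1 ?addr0// => j ji.
  by rewrite eq_sym (negPf ji) scale0r.
rewrite !key partial_parallel//; split=> //.
(* The parallel normal is the parallel map with [f] and [N] exchanged. *)
by rewrite (partial_parallel (f := N) (N := f))// addrC.
Qed.

(** * Curvatures of the parallel surface at a point *)

Section AtPoint.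
Variables (f N : 'rV[R]_2 -> 'M[R]_2) (p : 'rV[R]_2) (theta : R).
Hypothesis df : forall i, derivable f p (delta_mx 0 i).
Hypothesis dN : forall i, derivable N p (delta_mx 0 i).
Hypothesis fim : immersed_at f p.
Hypothesis hS : exists S, is_shape f N p S.

Let A := (cosh theta)%:M + sinh theta *: shape_op f N p.
Let B := (sinh theta)%:M + cosh theta *: shape_op f N p.

(** Expand the determinant with det S = K + 1 and tr S = -2H. *)
Lemma Delta_det : Delta f N theta p = \det A.
Proof.
rewrite /Delta /A det_scalar_addZ2 /gaussK /meanH cosh_double sinh_double.
by field.
Qed.

Lemma immersed_parallel :
  immersed_at (parallel f N theta) p <-> Delta f N theta p <> 0.
Proof.
rewrite Delta_det /immersed_at.
have dS k := parallel_partial_shape theta (@df k) (@dN k) (shape_opP hS).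
rewrite (dS 0).1 (dS 1).1.
rewrite (free2_mulmx (u := fun j => partial j f p))//.
by split => /eqP.
Qed.

Lemma shape_op_parallel : Delta f N theta p <> 0 ->
  shape_op (parallel f N theta) (parallel_normal f N theta) p = B *m invmx A.
Proof.
move=> D0; have ftim := (immersed_parallel).2 D0.
have Au : A \in unitmx by rewrite unitmxE unitfE -Delta_det; apply/eqP.
apply: shape_op_eq => // i.
have dS k := parallel_partial_shape theta (@df k) (@dN k) (shape_opP hS).
(* In the frame of [f] the claim reads B = (B A^-1) A, once the two sums are exchanged. *)
rewrite (dS i).2; under [RHS]eq_bigr do rewrite (dS _).1 scaler_sumr.
rewrite exchange_big; apply: eq_bigr => j _ /=.
under eq_bigr do rewrite scalerA.
by rewrite -scaler_suml -/A -/B -[in LHS](mulmxKV Au B) mxE.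
Qed.

(** This is det (B A^-1) det A = det B; the factor [Delta] is kept on the left so that the right
    side stays polynomial. *)
Lemma gaussK_parallel : Delta f N theta p <> 0 ->
  (gaussK (parallel f N theta) (parallel_normal f N theta) p + 1)
    * Delta f N theta p
  = gaussK f N p * cosh theta ^+ 2 - meanH f N p * sinh (2 * theta)
    + cosh (2 * theta).
Proof.
move=> D0; rewrite {1}/gaussK shape_op_parallel// subrK det_mulmx det_inv.
rewrite -Delta_det mulfVK; last exact/eqP.
rewrite /B det_scalar_addZ2 /gaussK /meanH cosh_double sinh_double; by field.
Qed.

(** As A^-1 is mxbar A / det A, multiplying by [Delta] turns tr (B A^-1) into the polynomial tr (B *
    mxbar A). *)
Lemma meanH_parallel : Delta f N theta p <> 0 ->
  meanH (parallel f N theta) (parallel_normal f N theta) p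
    * Delta f N theta p
  = meanH f N p * cosh (2 * theta)
    - (gaussK f N p + 2) * (sinh theta * cosh theta).
Proof.
move=> D0; rewrite {1}/meanH shape_op_parallel//.
rewrite invmx2 -?Delta_det; last exact/eqP.
rewrite -scalemxAr mxtraceZ mulrC mulrN mulrCA mulVKf; last exact/eqP.
rewrite /gaussK /meanH cosh_double det_mx2 /A /B /mxbar /mxtrace.
rewrite !(sum_ord2, mxE) /=; by field.
Qed.

End AtPoint.

End ParallelSurfaces.

Theorem theorem5p3 (R : realType) (Omega : set 'rV[R]_2)
    (f N : 'rV[R]_2 -> 'M[R]_2) (theta : R)
    (Omega_open : open Omega) (Omega_connected : connected Omega)
    (f_timelike : timelike_immersion Omega f)
    (N_normal : unit_normal Omega f N)
    (theta_neq0 : theta != 0) :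
  let ft := parallel f N theta in
  let Nt := parallel_normal f N theta in
  ((forall h : R, 1 < `|h| <->
      exists t : R, [/\ t != 0, h != 0 & tanh (2 * t) = 1 / h]) /\
   (forall H0 : R, (forall p, Omega p -> meanH f N p = H0) ->
      1 < `|H0| -> tanh (2 * theta) = 1 / H0 ->
      forall p, Omega p ->
      [/\ Delta f N theta p = gaussK f N p * sinh theta ^+ 2,
          immersed_at ft p <-> gaussK f N p <> 0,
          gaussK f N p <> 0 ->
            [/\ gaussK ft Nt p = 1 / sinh theta ^+ 2,
                0 < 1 / sinh theta ^+ 2
              & gaussK ft Nt p + 1 = coth theta ^+ 2]
        & gauss_map ft Nt p = gauss_map f N p]))
  /\
  (forall K0 : R, (forall p, Omega p -> gaussK f N p = K0) ->
     0 < K0 -> sinh theta ^+ 2 = 1 / K0 ->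
     forall p, Omega p ->
     [/\ Delta f N theta p =
           2 * cosh theta * (cosh theta - meanH f N p * sinh theta),
         immersed_at ft p <-> meanH f N p <> coth theta,
         meanH f N p <> coth theta ->
           meanH ft Nt p = - coth (2 * theta)
       & gauss_map ft Nt p = gauss_map f N p]).
Proof.
move=> ft Nt; have [sf fH fim _] := f_timelike; have [sN Nu] := N_normal.
have gmap p : Omega p -> gauss_map ft Nt p = gauss_map f N p.
  move=> Op; have [NN Nf _] := Nu p Op.
  by apply: gauss_map_parallel => //; exact: fH.
have df p (Op : Omega p) i : derivable f p (delta_mx 0 i).
  exact: smooth_derivable sf Op.
have dN p (Op : Omega p) i : derivable N p (delta_mx 0 i).
  exact: smooth_derivable sN Op.
have shape p (Op : Omega p) := shape_exists Omega_open f_timelike N_normal Op.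
have s0 : sinh theta != 0 by rewrite sinh_eq0.
have c0 : cosh theta != 0 by rewrite gt_eqF ?cosh_gt0.
have cs := coshB_sinh_sqr theta.
split; first split; first exact: tanh_double_range.
- move=> H0 fH0 H1 th p Op.
  have H0n : H0 != 0 by rewrite -normr_gt0 (lt_trans ltr01).
  (* This form of the condition on [theta] cancels the last two terms both of [Delta] and of the
     right side of [gaussK_parallel]. *)
  have Hs : H0 * sinh (2 * theta) = cosh (2 * theta).
    have c2 : cosh (2 * theta) != 0 by rewrite gt_eqF ?cosh_gt0.
    apply: (mulIf (invr_neq0 c2)); rewrite -mulrA -/(tanh _) th divff//.
    by rewrite div1r divff.
  have DE : Delta f N theta p = gaussK f N p * sinh theta ^+ 2.
    by rewrite /Delta fH0// Hs subrK.
  have K0E : Delta f N theta p <> 0 <-> gaussK f N p <> 0.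
    rewrite DE; split=> h; first by move=> K0; apply: h; rewrite K0 mul0r.
    by move/eqP; rewrite mulf_eq0 expf_eq0 /= (negPf s0) orbF => /eqP.
  have imm :=
    immersed_parallel theta (df p Op) (dN p Op) (fim p Op) (shape p Op).
  split; [by []|by rewrite imm|move=> K0|exact: gmap].
  have KE : gaussK ft Nt p + 1 = coth theta ^+ 2.
    have :=
      gaussK_parallel (df p Op) (dN p Op) (fim p Op) (shape p Op) (K0E.2 K0).
    rewrite DE fH0// Hs subrK => e.
    apply: (mulIf (_ : gaussK f N p * sinh theta ^+ 2 != 0)).
      by rewrite mulf_neq0 ?expf_neq0//; apply/eqP.
    by rewrite e /coth; field.
  split=> //; last by rewrite div1r invr_gt0 exprn_even_gt0.
  (* The value 1 / sinh^2 is coth^2 - 1, by cosh^2 - sinh^2 = 1. *)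
  apply: (addIr 1); rewrite KE /coth; apply: (mulIf (expf_neq0 2 s0)).
  have s20 : sinh theta ^+ 2 != 0 by rewrite expf_neq0.
  by rewrite expr_div_n divfK // mulrDl divfK // mul1r -[in RHS]cs subrK.
- move=> K0 fK0 K0p sK p Op.
  have Ks : gaussK f N p * sinh theta ^+ 2 = 1.
    by rewrite fK0// sK div1r divff// gt_eqF.
  have DE : Delta f N theta p =
      2 * cosh theta * (cosh theta - meanH f N p * sinh theta).
    (* The 1 coming from K sinh^2 is replaced by cosh^2 - sinh^2, so that cosh factors out. *)
    by rewrite /Delta Ks -{1}cs cosh_double sinh_double; ring.
  have H0E : Delta f N theta p <> 0 <-> meanH f N p <> coth theta.
    rewrite DE /coth; split=> h.
      by move=> e; apply: h; rewrite e divfK// subrr mulr0.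
    move/eqP; rewrite mulf_eq0 mulf_eq0 pnatr_eq0 (negPf c0) /= subr_eq0.
    by move=> /eqP e; apply: h; rewrite e mulfK.
  have imm :=
    immersed_parallel theta (df p Op) (dN p Op) (fim p Op) (shape p Op).
  split; [by []|by rewrite imm|move=> Hn|exact: gmap].
  have D0 := H0E.2 Hn.
  apply: (mulIf (_ : Delta f N theta p != 0)); first exact/eqP.
  rewrite (meanH_parallel (df p Op) (dN p Op) (fim p Op) (shape p Op) D0) DE.
  apply: (mulIf s0); rewrite /coth sinh_double cosh_double.
  (* Regrouped to exhibit K sinh^2 = 1. Then 1 + 2 sinh^2 = cosh^2 + sinh^2, and both sides equal
     (cosh^2 + sinh^2)(H sinh - cosh). *)
  transitivity (meanH f N p * (cosh theta ^+ 2 + sinh theta ^+ 2) * sinh theta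
     - (gaussK f N p * sinh theta ^+ 2 + 2 * sinh theta ^+ 2) * cosh theta).
    by ring.
  by rewrite Ks -{1}cs; field; rewrite s0 c0.
Qed.
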